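(* Let $K$ be an algebraically closed field of characteristic zero. (a) Let $s\ge 3$. If $(1,h_1,\dots,h_{s-2},h_{s-1},1)$ (a sequence indexed by $0,1,\dots,s$) is a Gorenstein O-sequence, then $$h_{s-1}\le h_1\quad\text{and}\quad h_{s-2}\le \binom{h_{s-1}+1}{2}+(h_1-h_{s-1}).$$ (b) If $h=(1,h_1,h_2,h_3,1)$ is a unimodal O-sequence satisfying $$h_3\le h_1\quad\text{and}\quad h_2\le \binom{h_3+1}{2}+(h_1-h_3),$$ then $h$ is a Gorenstein O-sequence.
   Context: $K$ is an algebraically closed field of characteristic zero. An Artinian local $K$-algebra is a ring $A=R/I$ of finite $K$-dimension, where $R=K[[x_1,\dots,x_r]]$ is a formal power series ring and $I$ is a proper ideal of $R$ (Artinian standard graded $K$-algebras are a special case); $\mathfrak m$ denotes its maximal ideal. Its Hilbert function (or $h$-vector) is $h=(h_0,h_1,\dots,h_s)$ with $h_i=\dim_K \mathfrak m^i/\mathfrak m^{i+1}$, where the socle degree $s$ is the largest integer $j$ with $\mathfrak m^j\neq 0$. $A$ is Gorenstein if $\dim_K(0:\mathfrak m)=1$. A sequence of positive integers $h=(h_0,h_1,\dots,h_s)$ is an O-sequence if $h_0=1$ and $h_{i+1}\le h_i^{\langle i\rangle}$ for $i=1,\dots,s-1$. Here, if $a=\binom{a_i}{i}+\binom{a_{i-1}}{i-1}+\cdots+\binom{a_j}{j}$ with $a_i>a_{i-1}>\cdots>a_j\ge j\ge 1$ is the $i$-binomial expansion of a positive integer $a$, then $a^{\langle i\rangle}=\binom{a_i+1}{i+1}+\binom{a_{i-1}+1}{i}+\cdots+\binom{a_j+1}{j+1}$.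 A sequence $h=(1,h_1,\dots,h_s)$ is a Gorenstein O-sequence if it is the Hilbert function of some Artinian Gorenstein local $K$-algebra (not required to be graded). A sequence $(h_0,\dots,h_s)$ is unimodal if there is an index $j$ with $h_0\le h_1\le\cdots\le h_j\ge h_{j+1}\ge\cdots\ge h_s$. *)

(* Defs.v *)
From HB Require Import structures.
From mathcomp Require Import all_boot all_order all_algebra falgebra.
From mathcomp Require Import boolp.
From mathcomp Require Import mpoly.

Set Implicit Arguments.
Unset Strict Implicit.
Unset Printing Implicit Defensive.

Import GRing.Theory.
Local Open Scope ring_scope.

(* K[[x_1, ..., x_r]]: a series is its coefficient function on multi-indices. *)
Definition mpseries (r : nat) (K : comNzRingType) : Type := 'X_{1..r} -> K.

Section PowerSeries.
Variables (r : nat) (K : comNzRingType).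
Implicit Types (f g h : mpseries r K) (m : 'X_{1..r}) (a : K).

HB.instance Definition _ := gen_eqMixin (mpseries r K).
HB.instance Definition _ := gen_choiceMixin (mpseries r K).

Let psadd f g : mpseries r K := fun m => f m + g m.
Let psopp f : mpseries r K := fun m => - f m.
Let pszero : mpseries r K := fun _ => 0.
Let psone : mpseries r K := fun m => (m == 0%MM)%:R.
Let psscale a f : mpseries r K := fun m => a * f m.
(* The bound on the degrees of k.1 and k.2 only makes the index type finite:
   the sum runs over all pairs of multi-indices with k.1 + k.2 = m. *)
Let psmul f g : mpseries r K := fun m =>
  \sum_(k : 'X_{1..r < (mdeg m).+1, (mdeg m).+1} | m == (k.1 + k.2)%MM)
    f k.1 * g k.2.

Let psaddA : associative psadd.
Proof. by move=> f g h; apply/funext => m; apply: addrA. Qed.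
Let psaddC : commutative psadd.
Proof. by move=> f g; apply/funext => m; apply: addrC. Qed.
Let psadd0 : left_id pszero psadd.
Proof. by move=> f; apply/funext => m; apply: add0r. Qed.
Let psaddN : left_inverse pszero psopp psadd.
Proof. by move=> f; apply/funext => m; apply: addNr. Qed.

HB.instance Definition _ := GRing.isZmodule.Build (mpseries r K)
  psaddA psaddC psadd0 psaddN.

Let trunc (d : nat) f : {mpoly K[r]} :=
  \sum_(m : 'X_{1..r < d}) f m *: 'X_[m].

Let mcoeff_trunc d f m : (mdeg m < d)%N -> (trunc d f)@_m = f m.
Proof.
move=> lt_m; rewrite /trunc raddf_sum /= (bigD1 (BMultinom lt_m)) //=.
rewrite mcoeffZ mcoeffX eqxx mulr1 big1 ?addr0 // => i ne_i.
rewrite mcoeffZ mcoeffX; case: eqP => [e|]; last by rewrite mulr0.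
by case/eqP: ne_i; apply/val_inj.
Qed.

Let psmul_trunc d f g m : (mdeg m < d)%N ->
  psmul f g m = (trunc d f * trunc d g)@_m.
Proof.
move=> lt_m; rewrite mcoeffM /psmul; apply: eq_bigr => k /eqP _.
by rewrite !mcoeff_trunc //; apply: leq_trans lt_m; rewrite bmdeg.
Qed.

Let mcoeffM_eq (p p' q q' : {mpoly K[r]}) m :
    (forall k, (mdeg k <= mdeg m)%N -> p@_k = p'@_k) ->
    (forall k, (mdeg k <= mdeg m)%N -> q@_k = q'@_k) ->
  (p * q)@_m = (p' * q')@_m.
Proof.
move=> Hp Hq; rewrite !mcoeffM; apply: eq_bigr => k _.
by rewrite Hp ?Hq // -ltnS bmdeg.
Qed.

Let psmulC : commutative psmul.
Proof.
by move=> f g; apply/funext => m; rewrite !(@psmul_trunc (mdeg m).+1) // mulrC.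
Qed.

Let psmulA : associative psmul.
Proof.
move=> f g h; apply/funext => m; set d := (mdeg m).+1.
rewrite !(@psmul_trunc d) //.
transitivity (trunc d f * (trunc d g * trunc d h))@_m.
  apply: mcoeffM_eq => // k le_k.
  by rewrite mcoeff_trunc ?ltnS // (@psmul_trunc d) ?ltnS.
rewrite mulrA; apply: mcoeffM_eq => // k le_k.
by rewrite mcoeff_trunc ?ltnS // (@psmul_trunc d) ?ltnS.
Qed.

Let psmul1 : left_id psone psmul.
Proof.
move=> f; apply/funext => m; set d := (mdeg m).+1.
rewrite (@psmul_trunc d) //.
rewrite -[RHS](@mcoeff_trunc d) // -[in RHS](mul1r (trunc d f)).
apply: mcoeffM_eq => // k le_k.
by rewrite mcoeff_trunc ?ltnS // mcoeff1.
Qed.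

Let psmulDl : left_distributive psmul psadd.
Proof.
move=> f g h; apply/funext => m; rewrite /psmul /psadd -big_split /=.
by apply: eq_bigr => k _; rewrite mulrDl.
Qed.

Let psone_neq0 : psone != pszero.
Proof.
apply/eqP => /(congr1 (fun f : mpseries r K => f 0%MM)).
by rewrite /psone /pszero eqxx => /eqP; rewrite oner_eq0.
Qed.

HB.instance Definition _ := GRing.Zmodule_isComNzRing.Build (mpseries r K)
  psmulA psmulC psmul1 psmulDl psone_neq0.

Let psscaleA a b f : psscale a (psscale b f) = psscale (a * b) f.
Proof. by apply/funext => m; apply: mulrA. Qed.
Let psscale1 : left_id 1 psscale.
Proof. by move=> f; apply/funext => m; apply: mul1r. Qed.
Let psscaleDr : right_distributive psscale +%R.
Proof. by move=> a f g; apply/funext => m; apply: mulrDr. Qed.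
Let psscaleDl f : {morph psscale^~ f : a b / a + b}.
Proof. by move=> a b; apply/funext => m; apply: mulrDl. Qed.

HB.instance Definition _ := GRing.Zmodule_isLmodule.Build K (mpseries r K)
  psscaleA psscale1 psscaleDr psscaleDl.

Let psscaleAl a f g : a *: (f * g) = a *: f * g.
Proof.
apply/funext => m; change (a * psmul f g m = psmul (psscale a f) g m).
by rewrite /psmul mulr_sumr; apply: eq_bigr => k _; apply: mulrA.
Qed.

HB.instance Definition _ := GRing.Lmodule_isLalgebra.Build K (mpseries r K)
  psscaleAl.

End PowerSeries.

Section LocalAlgebras.
Variables (K : fieldType) (A : falgType K).

(* A is, up to isomorphism, K[[x_1, ..., x_r]] / I with I = ker phi.  The ideal
   I is proper because 1 != 0 in a falgType, dim_K A is finite because A is a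
   falgType, and A is commutative because phi is onto. *)
Definition artinian_local : Prop :=
  exists r : nat, exists phi : {lrmorphism mpseries r K -> A},
    forall a : A, exists f : mpseries r K, phi f = a.

(* A is meant to be commutative; since it is a K-algebra, all its ideals are
   K-subspaces. *)
Definition is_ideal (J : {vspace A}) : Prop :=
  forall a x : A, x \in J -> a * x \in J.

Definition maximal_ideal (m : {vspace A}) : Prop :=
  [/\ is_ideal m, m != fullv &
      forall J : {vspace A}, is_ideal J -> (m <= J)%VS -> J != fullv -> J = m].

(* The library power U ^+ i of a subspace has U ^+ 0 = K 1, whereas the zeroth
   power of an ideal is A. *)
Definition ideal_exp (m : {vspace A}) (i : nat) : {vspace A} :=
  iter i (prodv m) fullv.

Definition hilbert_fun (m : {vspace A}) (i : nat) : nat :=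
  (\dim (ideal_exp m i) - \dim (ideal_exp m i.+1))%N.

Definition socle_degree (m : {vspace A}) (s : nat) : Prop :=
  ideal_exp m s != 0%VS /\
  forall j : nat, ideal_exp m j != 0%VS -> (j <= s)%N.

Definition has_hilbert_function (m : {vspace A}) (h : seq nat) : Prop :=
  exists2 s : nat, socle_degree m s & h = mkseq (hilbert_fun m) s.+1.

(* The annihilator (0 : m), as the intersection of the kernels of right
   multiplication by the elements of a basis of m. *)
Definition socle (m : {vspace A}) : {vspace A} :=
  (\bigcap_(x <- vbasis m) lker (amulr x))%VS.

Lemma socleP (m : {vspace A}) (a : A) :
  reflect (forall x, x \in m -> a * x = 0) (a \in socle m).
Proof.
have -> : (a \in socle m) = all (fun x => a * x == 0) (vbasis m).
  rewrite /socle; elim: (tval (vbasis m)) => [|x s IHs] /=.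
    by rewrite big_nil memvf.
  by rewrite big_cons memv_cap IHs memv_ker lfunE.
apply: (iffP allP) => [ann x xm | ann x xm]; last first.
  by apply/eqP/ann/vbasis_mem.
rewrite (coord_vbasis xm) mulr_sumr big1 // => i _.
by rewrite -scalerAr (eqP (ann _ _)) ?scaler0 // mem_nth // size_tuple.
Qed.

Definition gorenstein (m : {vspace A}) : Prop := \dim (socle m) = 1%N.

End LocalAlgebras.

Definition gorenstein_Osequence (K : fieldType) (h : seq nat) : Prop :=
  exists (A : falgType K) (m : {vspace A}),
    [/\ artinian_local A, maximal_ideal m, gorenstein m &
        has_hilbert_function m h].

(* c = [:: a_i; a_(i-1); ...; a_j] lists the upper entries of the i-binomial
   expansion of a, so that c`_k = a_(i-k) and j = i - (size c).-1. *)
Definition binomial_expansion (i a : nat) (c : seq nat) : Prop :=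
  [/\ (0 < size c <= i)%N,
      sorted (fun x y => y < x)%N c,
      (i - (size c).-1 <= last 0%N c)%N &
      a = (\sum_(k < size c) 'C(nth 0 c k, i - k))%N].

(* The expansion c exists and is unique when 0 < i and 0 < a. *)
Definition macaulay_exp (i a b : nat) : Prop :=
  exists2 c : seq nat, binomial_expansion i a c &
    b = (\sum_(k < size c) 'C((nth 0 c k).+1, (i - k).+1))%N.

Definition Osequence (h : seq nat) : Prop :=
  [/\ all (ltn 0) h, (0 < size h)%N, nth 0%N h 0 = 1%N &
      forall i : nat, (1 <= i)%N -> (i.+1 < size h)%N ->
        exists2 b : nat, macaulay_exp i (nth 0%N h i) b &
          (nth 0%N h i.+1 <= b)%N].

Definition unimodal (h : seq nat) : Prop :=
  exists2 j : nat, (j < size h)%N &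
    (forall i : nat, (i < j)%N -> (nth 0%N h i <= nth 0%N h i.+1)%N) /\
    (forall i : nat, (j <= i)%N -> (i.+1 < size h)%N ->
       (nth 0%N h i.+1 <= nth 0%N h i)%N).

(* Main.v *)
(* For (a), let s be the socle degree and phi a functional that is nonzero on
   the socle m^s, so that the form phi(ab) is nondegenerate. Then
   dim (0 : m^2) <= dim A/m^2 = 1 + h_1, and (0 : m^2) contains m^(s-1), of
   dimension 1 + h_(s-1). Pairing m with m^(s-1) yields t <= h_(s-1) elements
   v_i that span m modulo (0 : m^(s-1)). The C(t+1, 2) functionals
   a |-> phi(a v_i v_j) on m^(s-2) have their common kernel in (0 : m^2), which
   bounds dim m^(s-2) = 1 + h_(s-1) + h_(s-2).

   For (b), put n = h_3, b = max(0, h_2 - C(n+1, 2)) and c = h_1 - n - b. The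
   algebra is apolar to
     sum_(p in G) L_p^4 + sum_(k < b) Y_k^3 + sum_(l < c) Z_l^2,
   where the L_p are h_2 - b linear forms in X_1, ..., X_n, among them all the
   X_i, with linearly independent squares. The fourth powers contribute
   (1, n, h_2 - b, n, 1) to the Hilbert function, each cube (0, 1, 1, 0, 0) and
   each square (0, 1, 0, 0, 0). *)
From HB Require Import structures.
Require Import Defs.
From mathcomp Require Import all_boot all_order all_algebra falgebra.
From mathcomp Require Import zify ring boolp mpoly.

Set Implicit Arguments.
Unset Strict Implicit.
Unset Printing Implicit Defensive.

Import GRing.Theory.
Local Open Scope nat_scope.

(** * Counting pairs and choosing subsets of given size *)

Lemma card_le_pairs n :
  #|[set p : 'I_n * 'I_n | p.1 <= p.2]| = 'C(n.+1, 2).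
Proof.
(* The pairs are counted by their second entry [j], which leaves [j.+1] choices for the first. *)
have -> : 'C(n.+1, 2) = \sum_(j < n) j.+1.
  elim: n => [|n IHn]; first by rewrite big_ord0.
  by rewrite big_ord_recr /= -IHn [LHS]binS bin1 addnC.
rewrite -sum1dep_card.
rewrite (partition_big (fun p : 'I_n * 'I_n => p.2) xpredT) //=.
apply: eq_bigr => j _.
rewrite (reindex (fun i : 'I_n => (i, j))) /=; last first.
  exists fst => [i _ //|[i k]]; rewrite inE /= => /andP[_ /eqP->] //.
under eq_bigl => i do rewrite eqxx andbT.
rewrite sum1_card -[RHS](card_ord j.+1).
have le_jn : j.+1 <= n by [].
have widen_inj : injective (widen_ord le_jn) by move=> x y [/val_inj].
rewrite -(card_codom widen_inj).
apply: eq_card => i; rewrite unfold_in /=; apply/idP/codomP => [le_ij|[k ->]].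
  by exists (Ordinal (le_ij : i < j.+1)); apply: val_inj.
exact: ltn_ord k.
Qed.

(** Serves to choose the index set of the forms [L_p], which must contain the diagonal and have a
    prescribed size. *)
Lemma subset_of_card (T : finType) (D F : {set T}) k :
  D \subset F -> #|D| <= k <= #|F| ->
  exists G : {set T}, [/\ D \subset G, G \subset F & #|G| = k].
Proof.
move=> sDF /andP[le_Dk le_kF]; pose s := take (k - #|D|) (enum (F :\: D)).
have sFD : {subset s <= F :\: D} by move=> x /mem_take; rewrite mem_enum.
exists (D :|: [set x in s]); split; first exact: subsetUl.
  rewrite subUset sDF; apply/subsetP => x; rewrite inE => /sFD.
  by rewrite inE => /andP[].
have s_disj : D :&: [set x in s] = set0.
  apply/setP => x; rewrite !inE; apply/negP => /andP[xD /sFD].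
  by rewrite inE xD.
rewrite cardsU s_disj cards0 subn0 cardsE (card_uniqP _).
  rewrite size_take -cardE cardsDS //; case: ltnP => ?; lia.
by rewrite take_uniq // enum_uniq.
Qed.

Local Open Scope ring_scope.

(** * Bounds from the pairing on a Gorenstein algebra *)

Section CommonKernel.
Variables (K : fieldType) (vT : vectType K).

(** Rank-nullity for the map from [U] to [K^I] with components [g i]: its kernel lies in [W]. *)
Lemma dim_common_kernel (I : finType) (g : I -> 'Hom(vT, K^o))
    (U W : {vspace vT}) :
    (forall u, u \in U -> (forall i, g i u = 0) -> u \in W) ->
  (\dim U <= \dim W + #|I|)%N.
Proof.
move=> kerW.
pose G (u : vT) : {ffun I -> K^o} := [ffun i => g i u].
have G_linear : linear G.
  by move=> a u v; apply/ffunP => i; rewrite !ffunE linearP.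
pose lG : {linear vT -> {ffun I -> K^o}} :=
  HB.pack G (GRing.isLinear.Build _ _ _ _ G G_linear).
rewrite -(limg_ker_dim (linfun lG) U) leq_add //.
  apply/dimvS/subvP => u; rewrite memv_cap memv_ker lfunE /=.
  case/andP => uU /eqP Gu0; apply: kerW => // i.
  by have /ffunP/(_ i) := Gu0; rewrite !ffunE.
apply: leq_trans (dimvS (subvf _)) _.
by rewrite dimvf /dim /= muln1.
Qed.

Lemma exists_functional (S : {vspace vT}) : \dim S = 1%N ->
  exists phi : 'Hom(vT, K^o), forall a, a \in S -> phi a = 0 -> a = 0.
Proof.
move=> dimS; have i0 : 'I_(\dim S) by rewrite dimS; exact: ord0.
pose phi (a : vT) : K^o := coord (vbasis S) i0 (projv S a).
have phi_linear : linear phi by move=> k a b; rewrite /phi !linearP.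
pose lphi : {linear vT -> K^o} :=
  HB.pack phi (GRing.isLinear.Build _ _ _ _ phi phi_linear).
exists (linfun lphi) => a aS; rewrite lfunE /= /phi projv_id // => phi0.
rewrite (coord_vbasis aS) big1 // => i _.
rewrite (_ : i = i0) ?phi0 ?scale0r //.
apply: val_inj; move: i i0 {phi phi_linear lphi phi0}.
by rewrite dimS => i j; rewrite !ord1.
Qed.

End CommonKernel.

Section Pairing.
Variables (K : fieldType) (A : falgType K).
Implicit Types (U V W X : {vspace A}).

(** For [u] in [U], [phi (u * x)] depends only on [x] modulo [V]. Testing against a basis of a
    complement of [V] in [X] therefore forces [u] into [W]. *)
Lemma dim_pairing (phi : 'Hom(A, K^o)) U V W X :
    (V <= X)%VS ->
    (forall u v, u \in U -> v \in V -> phi (u * v) = 0) ->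
    (forall u, u \in U -> (forall x, x \in X -> phi (u * x) = 0) -> u \in W) ->
  (\dim U <= \dim W + (\dim X - \dim V))%N.
Proof.
move=> leVX UV0 kerW.
pose b := vbasis (X :\: V)%VS.
have <- : \dim (X :\: V)%VS = (\dim X - \dim V)%N.
  by rewrite -[in RHS](dimv_cap_compl X V) (capv_idPr leVX) addKn.
rewrite -[X in (_ + X)%N]card_ord.
pose g (i : 'I_(\dim (X :\: V))) : 'Hom(A, K^o) := (phi \o amulr b`_i)%VF.
apply: (dim_common_kernel (g := g)) => u uU gu0.
apply: kerW => // x; rewrite -[X](addv_diff_cap X V) (capv_idPr leVX).
case/memv_addP => y yXV [z zV ->].
rewrite mulrDr linearD /= (UV0 u z) // addr0 (coord_vbasis yXV) mulr_sumr.
rewrite linear_sum big1 // => i _; rewrite -scalerAr linearZ /=.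
by have := gu0 i; rewrite comp_lfunE lfunE /= => ->; rewrite scaler0.
Qed.

Lemma artinian_local_mulC : artinian_local A -> commutative (@GRing.mul A).
Proof.
case=> r [phi phi_onto] a b; have [f <-] := phi_onto a.
by have [g <-] := phi_onto b; rewrite -!rmorphM mulrC.
Qed.

Section IdealPowers.
Variable m : {vspace A}.
Hypotheses (mulC : commutative (@GRing.mul A)) (m_ideal : is_ideal m).

Lemma ideal_exp_ideal i : is_ideal (ideal_exp m i).
Proof.
case: i => [|i] a x xm; first exact: memvf.
have : (ideal_exp m i.+1 <= ideal_exp m i.+1 * fullv)%VS.
  by rewrite -[X in (X <= _)%VS]prodv1; apply: prodvSr; apply: subvf.
rewrite /ideal_exp iterS -/(ideal_exp m i) in xm *.
(* Stated as an inclusion in a preimage, the claim has to be checked only on products of two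
   elements, by [prodvP]. *)
suff: (m * ideal_exp m i <= lfun_preim (amull a) (m * ideal_exp m i))%VS.
  by move/subvP/(_ _ xm); rewrite -memv_preim lfunE.
apply/prodvP => y z ym zm.
by rewrite -memv_preim lfunE /= mulrA memv_mul ?m_ideal.
Qed.

Lemma ideal_exp1 : ideal_exp m 1 = m.
Proof.
apply/eqP; rewrite eqEsubv; apply/andP; split.
  by apply/prodvP => x y xm _; rewrite mulC m_ideal.
by rewrite -[X in (X <= _)%VS]prodv1; apply: prodvSr; apply: subvf.
Qed.

Lemma ideal_exp_mul i j x y :
  x \in ideal_exp m i -> y \in ideal_exp m j -> x * y \in ideal_exp m (i + j).
Proof.
move=> xm ym; elim: i x xm => [|i IHi] x xm; first exact: ideal_exp_ideal.
suff: (ideal_exp m i.+1 <= lfun_preim (amulr y) (ideal_exp m (i + j).+1))%VS.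
  by move/subvP/(_ _ xm); rewrite -memv_preim lfunE.
by apply/prodvP => u v um vm; rewrite -memv_preim lfunE /= -mulrA memv_mul ?IHi.
Qed.

Lemma ideal_expS i : (ideal_exp m i.+1 <= ideal_exp m i)%VS.
Proof. by apply/prodvP => x y _ ym; apply: ideal_exp_ideal. Qed.

Lemma dim_ideal_exp i :
  \dim (ideal_exp m i) = (hilbert_fun m i + \dim (ideal_exp m i.+1))%N.
Proof. by rewrite subnK // dimvS // ideal_expS. Qed.

End IdealPowers.

Section Gorenstein.
Variables (m : {vspace A}) (s : nat) (phi : 'Hom(A, K^o)).
Hypotheses (mulC : commutative (@GRing.mul A)) (m_ideal : is_ideal m).
Hypothesis deg_s : ideal_exp m s.+1 = 0%VS.
Hypothesis socle_s : socle m = ideal_exp m s.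
Hypothesis (phi_s : forall a, a \in ideal_exp m s -> phi a = 0 -> a = 0).

(** Induction shows that [a] kills ever larger powers of [m]. If [a] kills [m^(k+1)] and [x] is in
    [m^k], then [a * x] is in the socle [m^s], where [phi] is injective, so [a * x = 0]. At
    [m^0 = A] this gives [a * 1 = 0]. *)
Lemma pairing_nondegenerate a : (forall x, phi (a * x) = 0) -> a = 0.
Proof.
move=> phi0; suff ann i x : x \in ideal_exp m (s.+1 - i) -> a * x = 0.
  by rewrite -[a]mulr1; apply: (ann s.+1); rewrite subnn memvf.
elim: i x => [|i IHi] x xm.
  by move: xm; rewrite subn0 deg_s memv0 => /eqP->; rewrite mulr0.
apply: phi_s (phi0 x); rewrite -socle_s; apply/socleP => y ym.
rewrite -mulrA; apply: IHi; rewrite mulC.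
(* Once [i] exceeds [s], the truncated exponent stays at 0 and the power is all of [A]. *)
have [le_si|lt_is] := leqP s.+1 i; last first.
  rewrite (_ : s.+1 - i = 1 + (s.+1 - i.+1))%N; last by lia.
  by apply: ideal_exp_mul; rewrite ?ideal_exp1.
by rewrite (eqP (_ : s.+1 - i == 0)%N) ?memvf // subn_eq0.
Qed.

(** The form vanishes between [(0 : m^2)] and [m^2], so by nondegeneracy [(0 : m^2)] embeds into the
    dual of [A/m^2]. *)
Lemma dim_socle_sqr : (\dim (socle (ideal_exp m 2)) <=
  hilbert_fun m 0 + hilbert_fun m 1)%N.
Proof.
have := @dim_pairing phi (socle (ideal_exp m 2)) (ideal_exp m 2) 0%VS fullv.
rewrite (dim_ideal_exp m_ideal 0 : \dim fullv = _) (dim_ideal_exp m_ideal 1).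
rewrite dimv0 add0n addnA addnK; apply.
- exact: subvf.
- by move=> u v /socleP uv0 /uv0->; rewrite linear0.
move=> u _ u0; rewrite memv0; apply/eqP/pairing_nondegenerate => x.
by rewrite u0 ?memvf.
Qed.

Lemma gorenstein_bounds : (2 <= s)%N -> hilbert_fun m 0 = 1%N ->
    hilbert_fun m s = 1%N ->
  (hilbert_fun m (s - 1) <= hilbert_fun m 1)%N /\
  (hilbert_fun m (s - 2) <= 'C(hilbert_fun m (s - 1) + 1, 2) +
     (hilbert_fun m 1 - hilbert_fun m (s - 1)))%N.
Proof.
move=> s_ge2 h0 hs; pose M := ideal_exp m.
have dimM i := dim_ideal_exp m_ideal i.
have Ms : \dim (M s) = 1%N by rewrite dimM deg_s dimv0 hs.
have Ms1 : \dim (M (s - 1)%N) = (hilbert_fun m (s - 1) + 1)%N.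
  by rewrite dimM -subSn ?subSS ?subn0 ?Ms //; lia.
have Ms2 : \dim (M (s - 2)%N) =
    (hilbert_fun m (s - 2) + (hilbert_fun m (s - 1) + 1))%N.
  by rewrite dimM (_ : (s - 2).+1 = s - 1)%N ?Ms1 //; lia.
have dim2 : (\dim (socle (M 2%N)) <= 1 + hilbert_fun m 1)%N.
  by have := dim_socle_sqr; rewrite h0.
have le1 : (hilbert_fun m (s - 1) <= hilbert_fun m 1)%N.
  suff: (M (s - 1)%N <= socle (M 2%N))%VS by move/dimvS; rewrite Ms1; lia.
  apply/subvP => a am; apply/socleP => x xm.
  have := ideal_exp_mul m_ideal am xm.
  rewrite (_ : s - 1 + 2 = s.+1)%N; last by lia.
  by rewrite deg_s memv0 => /eqP.
split=> //; pose W := socle (M (s - 1)%N); pose t := \dim (m :\: W).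
(* The pairing of [m] with [m^(s-1)] factors through [m^(s-1)/m^s], as [m * m^s = 0], and its left
   kernel lies in [m :&: W]. *)
have le_t : (t <= hilbert_fun m (s - 1))%N.
  have := @dim_pairing phi m (M s) (m :&: W) (M (s - 1)%N).
  rewrite -[\dim m](dimv_cap_compl m W) leq_add2l Ms1 Ms addnK.
  apply.
  - by rewrite {1}(_ : s = (s - 1).+1)%N ?ideal_expS //; lia.
  - move=> u v um vm; rewrite (_ : u * v = 0) ?linear0 //; apply/eqP.
    by rewrite -memv0 -deg_s -add1n; apply: ideal_exp_mul; rewrite ?ideal_exp1.
  move=> u um u0; rewrite memv_cap um; apply/socleP => x xm.
  apply: phi_s (u0 x xm); rewrite (_ : s = 1 + (s - 1))%N; last by lia.
  by apply: ideal_exp_mul; rewrite ?ideal_exp1.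
pose b := vbasis (m :\: W).
pose J := {p : 'I_t * 'I_t | p \in [set p : 'I_t * 'I_t | (p.1 <= p.2)%N]}.
have := @dim_common_kernel K A J
  (fun p => phi \o amulr (b`_(val p).1 * b`_(val p).2))%VF
  (M (s - 2)%N) (socle (M 2%N)).
rewrite card_sig card_le_pairs Ms2 => le2.
suff: (hilbert_fun m (s - 2) + (hilbert_fun m (s - 1) + 1) <=
    1 + hilbert_fun m 1 + 'C((hilbert_fun m (s - 1)).+1, 2))%N.
  by rewrite !addn1; lia.
apply: leq_trans (le2 _) _; last first.
  by rewrite leq_add //; apply: leq_bin2l.
move=> a am gab; apply/socleP.
suff: (M 2%N <= lker (amull a))%VS.
  by move=> /subvP le x /le; rewrite memv_ker lfunE => /eqP.
have axy x y : x \in m -> y \in m -> a * (x * y) \in M s.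
  move=> xm ym; rewrite (_ : s = s - 2 + (1 + 1))%N; last by lia.
  by do 2?apply: ideal_exp_mul => //; rewrite ideal_exp1.
have phib i j : phi (a * (b`_i * b`_j)) = 0.
  (* Only pairs with [i <= j] index a functional; commutativity gives the others. From index [t] on,
     [nth] returns its default 0. *)
  wlog le_ij : i j / (i <= j)%N.
    move=> H; have [/H //|/ltnW/H] := leqP i j.
    by rewrite [b`_j * _]mulC.
  have [lt_jt|] := ltnP j t; last first.
    by move=> ?; rewrite [b`_j]nth_default ?size_tuple // !mulr0 linear0.
  have pJ : (Ordinal (leq_ltn_trans le_ij lt_jt), Ordinal lt_jt)
     \in [set p : 'I_t * 'I_t | (p.1 <= p.2)%N] by rewrite inE.
  have := gab (exist (fun p => is_true (p \in _)) _ pJ).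
  by rewrite comp_lfunE lfunE.
have mE x : x \in m -> exists c : 'I_t -> K,
    exists2 w, w \in W & x = \sum_i c i *: b`_i + w.
  rewrite -{1}(addv_diff_cap m W) => /memv_addP[y yW [w]].
  rewrite memv_cap => /andP[_ wW] ->.
  by exists (coord b ^~ y) => //; exists w; rewrite // -coord_vbasis.
(* Here [a * y] lies in [m^(s-1)], which [w] annihilates. *)
have Wm w y : w \in W -> y \in m -> a * (w * y) = 0.
  move=> /socleP wW ym; rewrite mulC -mulrA wW // mulC.
  rewrite (_ : s - 1 = (s - 2) + 1)%N; last by lia.
  by apply: ideal_exp_mul; rewrite ?ideal_exp1.
have bm i : b`_i \in m.
  have [lt_it|ge_it] := ltnP i t; last first.
    by rewrite nth_default ?size_tuple ?mem0v.
  apply: (subvP (diffvSl m W)); apply: vbasis_mem.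
  by apply: mem_nth; rewrite size_tuple.
rewrite /M /ideal_exp iterS -/(ideal_exp m 1) ideal_exp1 //.
apply/prodvP => x y xm ym; rewrite memv_ker lfunE /=; apply/eqP.
(* Since [phi] is injective on [m^s], it suffices that [phi (a * (x * y)) = 0]. Expanding [x] and
   [y] in the [b_i] modulo [W] leaves only the terms covered by [phib]. *)
apply: phi_s (axy _ _ xm ym) _.
have [c [w wW ->]] := mE _ xm; rewrite mulrDl mulrDr (Wm w) // addr0.
rewrite mulr_suml mulr_sumr linear_sum big1 // => i _.
have [d [z zW ->]] := mE _ ym.
rewrite -scalerAl -scalerAr linearZ /= mulrDr mulrDr.
rewrite [a * (b`_i * z)](_ : _ = 0) ?addr0; last by rewrite [b`_i * z]mulC Wm.
rewrite !mulr_sumr linear_sum big1 ?scaler0 // => j _.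
by rewrite -!scalerAr linearZ /= phib scaler0.
Qed.

End Gorenstein.

End Pairing.

(** * Presenting an algebra with a nilpotent ideal of codimension one *)

Section Generation.
Variables (K : fieldType) (A : falgType K) (r d : nat) (x : 'I_r -> A).
Hypothesis mulC : commutative (@GRing.mul A).

Local Notation ev := (mmap (in_alg A) x).

Let evM p q : ev (p * q) = ev p * ev q.
Proof.
case: (@commr_mmap_is_multiplicative r K A x (in_alg A)) => *;
  by rewrite /GRing.comm.
Qed.

Let ev1 : ev 1 = 1.
Proof. by rewrite -mpolyC1 mmapC /= scale1r. Qed.

Let evZ (a : K) (p : {mpoly K[r]}) : ev (a *: p) = a *: ev p.
Proof. by rewrite mmapZ /= mulr_algl. Qed.

Hypothesis x_nilp : forall m : 'X_{1..r}, (d <= mdeg m)%N -> mmap1 x m = 0.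

Let trunc (f : mpseries r K) : {mpoly K[r]} :=
  \sum_(m : 'X_{1..r < d}) f m *: 'X_[m].

Let mcoeff_trunc f m : (mdeg m < d)%N -> (trunc f)@_m = f m.
Proof.
move=> lt_m; rewrite /trunc raddf_sum /= (bigD1 (BMultinom lt_m)) //=.
rewrite mcoeffZ mcoeffX eqxx mulr1 big1 ?addr0 // => i ne_i.
rewrite mcoeffZ mcoeffX; case: eqP => [e|]; last by rewrite mulr0.
by case/eqP: ne_i; apply/val_inj.
Qed.

(** Monomials of degree at least [d] vanish at [x]. Hence evaluating truncated series is
    multiplicative, although truncation itself is not. *)
Let ev_eq (p q : {mpoly K[r]}) :
  (forall m, (mdeg m < d)%N -> p@_m = q@_m) -> ev p = ev q.
Proof.
move=> pq; apply/eqP; rewrite -subr_eq0 -mmapB /mmap big1 // => m _.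
have [lt_md|/x_nilp->] := ltnP (mdeg m) d; last by rewrite mulr0.
by rewrite mcoeffB pq // subrr raddf0 mul0r.
Qed.

Let phi f : A := ev (trunc f).

Let phi_linear : linear phi.
Proof.
move=> a f g; rewrite /phi -evZ -mmapD; apply: ev_eq => m lt_md.
by rewrite mcoeffD mcoeffZ !mcoeff_trunc.
Qed.

Let phi_monoid : monoid_morphism phi.
Proof.
split.
  rewrite -ev1; apply: ev_eq => m lt_md.
  by rewrite mcoeff_trunc // mcoeff1.
move=> f g; rewrite /phi -evM; apply: ev_eq => m lt_md.
rewrite mcoeff_trunc // mcoeffM.
apply: eq_bigr => k _; rewrite !mcoeff_trunc //;
  by apply: leq_trans lt_md; rewrite bmdeg.
Qed.

Lemma artinian_local_generated :
  (forall a, exists p, a = ev p) -> artinian_local A.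
Proof.
move=> ev_onto; exists r.
pose Phi : {lrmorphism mpseries r K -> A} := HB.pack phi
  (GRing.isLinear.Build _ _ _ _ phi phi_linear)
  (GRing.isMonoidMorphism.Build _ _ phi phi_monoid).
exists Phi => a; have [p ->] := ev_onto a; exists (fun m => p@_m).
by apply: ev_eq => m lt_md; rewrite mcoeff_trunc.
Qed.

End Generation.

(** The variables are sent to a basis of [m]. Polynomials of degree at most 1 already reach all of
    [A], and monomials of degree at least [d] go to [m^d = 0]. *)
Lemma artinian_local_nilpotent (K : fieldType) (A : falgType K)
    (m : {vspace A}) (d : nat) :
    commutative (@GRing.mul A) -> is_ideal m -> ideal_exp m d = 0%VS ->
    (forall a : A, exists k : K, a - k *: 1 \in m) ->
  artinian_local A.
Proof.
move=> mulC m_ideal md0 m_codim1; pose x (i : 'I_(\dim m)) : A := (vbasis m)`_i.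
have xm i : x i \in m by apply: vbasis_mem; rewrite mem_nth ?size_tuple.
apply: (@artinian_local_generated _ _ _ d x mulC) => [e le_de|a].
  suff: mmap1 x e \in ideal_exp m (mdeg e).
    rewrite -(subnKC le_de) => xe; apply/eqP; rewrite -memv0 -md0.
    elim: (_ - _)%N xe => [|k IHk]; first by rewrite addn0.
    by rewrite addnS => /(subvP (ideal_expS m_ideal _)).
  rewrite mdegE /mmap1; elim/big_rec2: _ => [|i k y _ ym]; first exact: memvf.
  apply: ideal_exp_mul => //; elim: (e i) => [|j IHj]; first exact: memvf.
  by rewrite exprS /ideal_exp iterS memv_mul.
have [k am] := m_codim1 a.
exists (k%:MP + \sum_i coord (vbasis m) i (a - k *: 1) *: 'X_i).
rewrite mmapD mmapC /= raddf_sum /=.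
under eq_bigr => i _ do rewrite mmapZ /= mmapX mmap1U mulr_algl.
by rewrite -(coord_vbasis am) addrC subrK.
Qed.

(** * Adjoining a unit to a commutative non-unital algebra *)

Record comNonUnital (K : fieldType) := ComNonUnital {
  cn_sort :> vectType K;
  cn_mul : cn_sort -> cn_sort -> cn_sort;
  cn_mulC : commutative cn_mul;
  cn_mulA : associative cn_mul;
  cn_mulDl : left_distributive cn_mul +%R;
  cn_mulZl : forall a x y, cn_mul (a *: x) y = a *: cn_mul x y }.

(** A name of its own keeps the algebra structure with unit [(1, 0)] apart from the componentwise
    structures on a product. *)
Definition unitization (K : fieldType) (N : comNonUnital K) : Type :=
  (K^o * N)%type.

Section Unitization.
Variables (K : fieldType) (N : comNonUnital K).
Local Notation A := (unitization N).
Implicit Types (a b c : A).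

HB.instance Definition _ := Vector.copy A (K^o * N)%type.

Lemma unitization_eq a b : a.1 = b.1 -> a.2 = b.2 -> a = b.
Proof. by case: a b => [? ?] [? ?] /= -> ->. Qed.

Let mul a b : A := (a.1 * b.1 : K^o, a.1 *: b.2 + b.1 *: a.2 + cn_mul a.2 b.2).
Let one : A := (1, 0).

Let cn_mulDr (p q t : N) : cn_mul p (q + t) = cn_mul p q + cn_mul p t.
Proof. by rewrite !(cn_mulC p) cn_mulDl. Qed.
Let cn_mulZr k (p q : N) : cn_mul p (k *: q) = k *: cn_mul p q.
Proof. by rewrite !(cn_mulC p) cn_mulZl. Qed.
Let cn_mul0l (p : N) : cn_mul 0 p = 0.
Proof. by have := cn_mulZl (0 : K) (0 : N) p; rewrite !scale0r. Qed.

Let mulC : commutative mul.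
Proof.
move=> a b; apply: unitization_eq => /=; first exact: mulrC.
by rewrite cn_mulC (addrC (a.1 *: _)).
Qed.

Let mulA : associative mul.
Proof.
move=> a b c; apply: unitization_eq => /=; first exact: mulrA.
rewrite !scalerDr !cn_mulDl !cn_mulDr !cn_mulZl !cn_mulZr cn_mulA !scalerA.
rewrite (mulrC c.1 a.1) (mulrC c.1 b.1) -!addrA; congr (_ + (_ + _)).
rewrite addrCA; congr (_ + _); rewrite [RHS]addrCA; congr (_ + _).
by rewrite addrCA.
Qed.

Let mul1 : left_id one mul.
Proof.
move=> [a p]; apply: unitization_eq => /=; first exact: mul1r.
by rewrite scale1r scaler0 cn_mul0l !addr0.
Qed.

Let mulDl : left_distributive mul +%R.
Proof.
move=> a b c; apply: unitization_eq => /=; first exact: mulrDl.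
rewrite scalerDl scalerDr cn_mulDl (addrACA (a.1 *: c.2)); exact: addrACA.
Qed.

Let one_neq0 : one != 0.
Proof. by apply/eqP => -[/eqP]; rewrite oner_eq0. Qed.

HB.instance Definition _ := GRing.Zmodule_isComNzRing.Build A
  mulA mulC mul1 mulDl one_neq0.

Let scaleAl (k : K) a b : k *: (a * b) = k *: a * b.
Proof.
apply: unitization_eq => /=; first exact: mulrA.
by rewrite !scalerDr !scalerA cn_mulZl (mulrC k b.1).
Qed.

HB.instance Definition _ := GRing.Lmodule_isLalgebra.Build K A scaleAl.
HB.instance Definition _ := GRing.Lalgebra_isComAlgebra.Build K A.
HB.instance Definition _ := Algebra_isFalgebra.Build K A.

End Unitization.

Section Embedding.
Variables (K : fieldType) (N : comNonUnital K).
Implicit Types (a : unitization N) (p : N).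

Definition unit_emb (p : N) : unitization N := (0, p).

Fact unit_emb_linear : linear unit_emb.
Proof. by move=> k p q; apply: unitization_eq; rewrite //= scaler0 addr0. Qed.

HB.instance Definition _ :=
  GRing.isLinear.Build K N (unitization N) _ unit_emb unit_emb_linear.

Lemma unit_embM p q : unit_emb (cn_mul p q) = unit_emb p * unit_emb q.
Proof.
apply: unitization_eq => /=; first by rewrite mul0r.
by rewrite !scale0r !add0r.
Qed.

Lemma unit_embE (a : unitization N) : a.1 = 0 -> a = unit_emb a.2.
Proof. by move=> a0; apply: unitization_eq. Qed.

Lemma unit_mul1 (a a' : unitization N) : (a * a').1 = a.1 * a'.1.
Proof. by []. Qed.

Lemma unit_mul_emb a p : (a * unit_emb p).2 = a.1 *: p + cn_mul a.2 p.
Proof. by rewrite /= scale0r addr0. Qed.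

Lemma unit_mul2 (a a' : unitization N) :
  a.1 = 0 -> a'.1 = 0 -> (a * a').2 = cn_mul a.2 a'.2.
Proof. by move=> a0 a'0; rewrite /= a0 a'0 !scale0r !add0r. Qed.

Lemma unit_sub_scalar (a : unitization N) (k : K) : (a - k *: 1).1 = a.1 - k.
Proof. by rewrite -[in RHS](mulr1 k). Qed.

End Embedding.

Lemma dim_lker_onto (K : fieldType) (V T : vectType K) (f : {linear V -> T}) :
  (forall y, exists x, f x = y) -> (\dim (lker (linfun f)) + dim T)%N = dim V.
Proof.
move=> f_onto.
rewrite -dimvf -[dim V]dimvf -(limg_ker_dim (linfun f) fullv) capfv.
congr (_ + \dim _)%N; apply/eqP; rewrite eqEsubv subvf andbT.
apply/subvP => y _; have [x <-] := f_onto y.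
by have := memv_img (linfun f) (memvf x); rewrite lfunE.
Qed.

Section PairWithScalar.
Variables (K : fieldType) (N : comNonUnital K) (T : vectType K).
Variable g : {linear N -> T}.

(** Its kernel is the copy of the kernel of [g] inside the ideal [N]; steps of the filtration of the
    apolar algebra arise in this way. *)
Definition unit_pair (a : unitization N) : K^o * T := (a.1, g a.2).

Fact unit_pair_linear : linear unit_pair.
Proof. by move=> k a a'; rewrite /unit_pair /= linearP. Qed.

HB.instance Definition _ :=
  GRing.isLinear.Build K (unitization N) (K^o * T)%type _ unit_pair
    unit_pair_linear.

Lemma mem_unit_pair_ker a :
  a \in lker (linfun unit_pair) <-> a.1 = 0 /\ g a.2 = 0.
Proof.
rewrite memv_ker lfunE; split=> [/eqP e|[a0 g0]].
  by split; [exact: (congr1 fst e)|exact: (congr1 snd e)].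
by apply/eqP; exact: (f_equal2 pair a0 g0).
Qed.

Lemma dim_unit_pair_ker : (forall y, exists p, g p = y) ->
  (\dim (lker (linfun unit_pair)) + dim T)%N = dim N.
Proof.
move=> g_onto; have := @dim_lker_onto _ _ _ unit_pair.
rewrite (erefl : dim (unitization N) = (1 + dim N)%N).
rewrite (erefl : dim (K^o * T)%type = (1 + dim T)%N) addnCA => dimE.
apply/eqP; rewrite -(eqn_add2l 1) dimE // => -[k y].
by have [p <-] := g_onto y; exists (k, p).
Qed.

End PairWithScalar.

Lemma sum_delta (R : pzRingType) (I : finType) (g : I -> R) i :
  \sum_j g j * (j == i)%:R = g i.
Proof.
by rewrite (bigD1 i) //= eqxx mulr1 big1 ?addr0 // => j /negPf->; rewrite mulr0.
Qed.

(** * The apolar algebra *)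

Section ApolarAlgebra.
Variables (K : fieldType) (n b c : nat) (J : finType) (L : 'I_n -> J -> K).

(* The maximal ideal of the algebra of differential operators modulo those that
   annihilate sum_q L_q^4 + sum_k Y_k^3 + sum_l Z_l^2, up to normalization of
   the scalars; L i q is the coefficient of X_i in L_q. In the order of the
   factors: the coordinates x, y, z of an operator of degree 1; in degree 2, its
   values w and v on the squares L_q^2 and Y_k^2; in degree 3, the socle
   coordinates f of its products with the d/dX_i; and the socle coordinate t. *)
Definition apolar_nil : Type :=
  ({ffun 'I_n -> K^o} * {ffun 'I_b -> K^o} * {ffun 'I_c -> K^o} *
   ({ffun J -> K^o} * {ffun 'I_b -> K^o}) * {ffun 'I_n -> K^o} * K^o)%type.

HB.instance Definition _ := Vector.copy apolar_nil
  ({ffun 'I_n -> K^o} * {ffun 'I_b -> K^o} * {ffun 'I_c -> K^o} *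
   ({ffun J -> K^o} * {ffun 'I_b -> K^o}) * {ffun 'I_n -> K^o} * K^o)%type.

Local Notation N := apolar_nil.
Implicit Types p : N.

Definition cx p (i : 'I_n) : K := p.1.1.1.1.1 i.
Definition cy p (k : 'I_b) : K := p.1.1.1.1.2 k.
Definition cz p (l : 'I_c) : K := p.1.1.1.2 l.
Definition cw p (q : J) : K := p.1.1.2.1 q.
Definition cv p (k : 'I_b) : K := p.1.1.2.2 k.
Definition cf p (i : 'I_n) : K := p.1.2 i.
Definition ct p : K := p.2.

(* Locked, because a sum in apolar_nil is convertible to a tuple: an unlocked
   mkN lets mkNE rewrite inside sums. *)
Definition mkN (x : 'I_n -> K) (y : 'I_b -> K) (z : 'I_c -> K) (w : J -> K)
    (v : 'I_b -> K) (f : 'I_n -> K) (t : K) : N :=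
  locked
  ([ffun i => x i : K^o], [ffun i => y i : K^o], [ffun i => z i : K^o],
   ([ffun i => w i : K^o], [ffun i => v i : K^o]), [ffun i => f i : K^o],
   t : K^o).

Lemma mkNE x y z w v f t (p := mkN x y z w v f t) :
  (cx p =1 x) * (cy p =1 y) * (cz p =1 z) * (cw p =1 w) * (cv p =1 v) *
  (cf p =1 f) * (ct p = t).
Proof. by rewrite /p /mkN -lock; do !split; move=> i; exact: ffunE. Qed.

Lemma apolar_nilP p p' :
  cx p =1 cx p' -> cy p =1 cy p' -> cz p =1 cz p' -> cw p =1 cw p' ->
  cv p =1 cv p' -> cf p =1 cf p' -> ct p = ct p' -> p = p'.
Proof.
case: p p' => [[[[[x y] z] [w v]] f] t] [[[[[x' y'] z'] [w' v']] f'] t'].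
move=> /ffunP xE /ffunP yE /ffunP zE /ffunP wE /ffunP vE /ffunP fE tE.
by rewrite /cx /cy /cz /cw /cv /cf /ct /= in xE yE zE wE vE fE tE; subst.
Qed.

Lemma coordD p p' :
  (forall i, cx (p + p') i = cx p i + cx p' i) *
  (forall i, cy (p + p') i = cy p i + cy p' i) *
  (forall i, cz (p + p') i = cz p i + cz p' i) *
  (forall i, cw (p + p') i = cw p i + cw p' i) *
  (forall i, cv (p + p') i = cv p i + cv p' i) *
  (forall i, cf (p + p') i = cf p i + cf p' i) *
  (ct (p + p') = ct p + ct p').
Proof.
split; last by [].
do 5?[split; last by move=> i; rewrite /cx /cy /cz /cw /cv /cf /= ffunE].
by move=> i; rewrite /cx /= ffunE.
Qed.

Lemma coordZ a p :
  (forall i, cx (a *: p) i = a * cx p i) *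
  (forall i, cy (a *: p) i = a * cy p i) *
  (forall i, cz (a *: p) i = a * cz p i) *
  (forall i, cw (a *: p) i = a * cw p i) *
  (forall i, cv (a *: p) i = a * cv p i) *
  (forall i, cf (a *: p) i = a * cf p i) *
  (ct (a *: p) = a * ct p).
Proof.
split; last by [].
do 5?[split; last by move=> i; rewrite /cx /cy /cz /cw /cv /cf /= ffunE].
by move=> i; rewrite /cx /= ffunE.
Qed.

(** The value on [L_q] of the operator with coordinates [x]. *)
Definition ell (x : 'I_n -> K) (q : J) : K := \sum_i L i q * x i.

(** Composition of operators, by degree. Degrees 1 + 1 give values on [L_q^2] and [Y_k^2]; degrees 1
    + 2 give [f], after a further product with [d/dX_i]. The coordinate [t] collects 2 + 2 and 1 + 3
    from the fourth powers, 1 + 2 from the cubes and 1 + 1 from the squares [Z_l^2]. *)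
Definition apolar_mul p p' : N := mkN (fun=> 0) (fun=> 0) (fun=> 0)
  (fun q => ell (cx p) q * ell (cx p') q) (fun k => cy p k * cy p' k)
  (fun i => \sum_q L i q * (ell (cx p) q * cw p' q + ell (cx p') q * cw p q))
  (\sum_q cw p q * cw p' q + \sum_i (cx p i * cf p' i + cx p' i * cf p i) +
   \sum_k (cy p k * cv p' k + cy p' k * cv p k) + \sum_l cz p l * cz p' l).

Lemma ellD x x' q : ell (fun i => x i + x' i) q = ell x q + ell x' q.
Proof. by rewrite /ell -big_split /=; apply: eq_bigr => i _; ring. Qed.

Lemma ellZ a x q : ell (fun i => a * x i) q = a * ell x q.
Proof. by rewrite /ell mulr_sumr; apply: eq_bigr => i _; ring. Qed.

Lemma ell0 q : ell (fun=> 0) q = 0.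
Proof. by rewrite /ell big1 // => i _; rewrite mulr0. Qed.

Lemma eq_ell x x' : x =1 x' -> ell x =1 ell x'.
Proof. by move=> xx' q; apply: eq_bigr => i _; rewrite xx'. Qed.

(** Rewrites the pairing of degree 1 with degree 3 as a sum over the forms [L_q], where triple
    products become symmetric. *)
Lemma ell_adjoint x (w : J -> K) :
  \sum_i x i * (\sum_q L i q * w q) = \sum_q ell x q * w q.
Proof.
under eq_bigr => i _ do rewrite mulr_sumr.
rewrite exchange_big /=; apply: eq_bigr => q _.
by rewrite /ell mulr_suml; apply: eq_bigr => i _; ring.
Qed.

Lemma apolar_mulC : commutative apolar_mul.
Proof.
move=> p p'; apply: apolar_nilP => [i|i|i|i|i|i|]; rewrite !mkNE //.
- exact: mulrC.
- exact: mulrC.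
- by apply: eq_bigr => q _; rewrite addrC.
congr (_ + _ + _ + _); apply: eq_bigr => i _;
  by [exact: mulrC|exact: addrC].
Qed.

Lemma ell_cx_mul p p' q : ell (cx (apolar_mul p p')) q = 0.
Proof. by rewrite (@eq_ell _ (fun=> 0)) ?ell0 // => i; rewrite mkNE. Qed.

Lemma apolar_mulA : associative apolar_mul.
Proof.
(* This expression is symmetric in the three factors, so associativity follows from
   commutativity. *)
suff mul3 p p' p'' : apolar_mul (apolar_mul p p') p'' =
    mkN (fun=> 0) (fun=> 0) (fun=> 0) (fun=> 0) (fun=> 0)
      (fun i => \sum_q L i q * (ell (cx p) q * ell (cx p') q * ell (cx p'') q))
      (\sum_q (ell (cx p) q * ell (cx p') q * cw p'' q +
               ell (cx p) q * ell (cx p'') q * cw p' q +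
               ell (cx p') q * ell (cx p'') q * cw p q) +
       \sum_k cy p k * cy p' k * cy p'' k).
  move=> p p' p''; rewrite apolar_mulC !mul3; congr mkN.
    by apply/funext => i; apply: eq_bigr => q _; ring.
  by congr (_ + _); apply: eq_bigr => q _; ring.
apply: apolar_nilP => [i|i|i|i|i|i|]; rewrite !mkNE //.
- by rewrite ell_cx_mul mul0r.
- by rewrite mul0r.
- by apply: eq_bigr => q _; rewrite ell_cx_mul mkNE; ring.
rewrite [X in _ + X]big1 => [|l _]; last by rewrite mkNE mul0r.
rewrite addr0; congr (_ + _); last first.
  by apply: eq_bigr => k _; rewrite !mkNE; ring.
under [X in _ + X]eq_bigr => i _ do rewrite !mkNE mul0r add0r.
rewrite ell_adjoint -big_split; apply: eq_bigr => q _ /=.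
by rewrite mkNE; ring.
Qed.

Lemma apolar_mulDl : left_distributive apolar_mul +%R.
Proof.
move=> p p' r; have ellp q : ell (cx (p + p')) q = ell (cx p) q + ell (cx p') q.
  by rewrite -ellD; apply: eq_ell => i; rewrite coordD.
apply: apolar_nilP => [i|i|i|i|i|i|]; rewrite coordD !mkNE ?addr0 //.
- by rewrite ellp mulrDl.
- by rewrite coordD mulrDl.
- by rewrite -big_split; apply: eq_bigr => q _ /=; rewrite ellp coordD; ring.
rewrite (addrACA _ (\sum_l _)) (addrACA _ (\sum_k _)) (addrACA (\sum_q _)).
rewrite -!big_split; congr (_ + _ + _ + _);
  by apply: eq_bigr => i _ /=; rewrite !coordD; ring.
Qed.

Lemma apolar_mulZl a p r : apolar_mul (a *: p) r = a *: apolar_mul p r.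
Proof.
have ellp q : ell (cx (a *: p)) q = a * ell (cx p) q.
  by rewrite -ellZ; apply: eq_ell => i; rewrite coordZ.
apply: apolar_nilP => [i|i|i|i|i|i|]; rewrite coordZ !mkNE ?mulr0 //.
- by rewrite ellp mulrA.
- by rewrite coordZ mulrA.
- by rewrite mulr_sumr; apply: eq_bigr => q _; rewrite ellp coordZ; ring.
rewrite !mulrDr !mulr_sumr; congr (_ + _ + _ + _);
  by apply: eq_bigr => i _; rewrite !coordZ; ring.
Qed.

Definition apolar : comNonUnital K :=
  ComNonUnital apolar_mulC apolar_mulA apolar_mulDl apolar_mulZl.

End ApolarAlgebra.

(** * The degree filtration of the apolar algebra, its socle and its Hilbert function *)

Section Hilbert.
Variables (K : fieldType) (n b c : nat) (J : finType) (L : 'I_n -> J -> K).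
Local Notation N := (apolar b c L).
Local Notation A := (unitization N).
Implicit Types (a : A) (p : N).

(** The coordinates [x], [y], [z] have degree 1, [w] and [v] degree 2, [f] degree 3 and [t] degree
    4; each guard says that this degree is below [i]. *)
Definition deg_ge i p : Prop :=
  [/\ (2 <= i)%N -> [/\ cx p =1 fun=> 0, cy p =1 fun=> 0 & cz p =1 fun=> 0],
      (3 <= i)%N -> (cw p =1 fun=> 0) /\ (cv p =1 fun=> 0),
      (4 <= i)%N -> cf p =1 fun=> 0 &
      (5 <= i)%N -> ct p = 0].

Definition below4 p := p.1.
Fact below4_linear : linear below4. Proof. by []. Qed.
HB.instance Definition _ := GRing.isLinear.Build K N _ _ below4 below4_linear.

Definition below3 p := p.1.1.
Fact below3_linear : linear below3.
Proof. exact: (linearP (fst \o below4)). Qed.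
HB.instance Definition _ := GRing.isLinear.Build K N _ _ below3 below3_linear.

Definition below2 p := p.1.1.1.
Fact below2_linear : linear below2.
Proof. exact: (linearP (fst \o below3)). Qed.
HB.instance Definition _ := GRing.isLinear.Build K N _ _ below2 below2_linear.

Definition pr1 (a : A) : K^o := a.1.
Fact pr1_linear : linear pr1. Proof. by []. Qed.
HB.instance Definition _ := GRing.isLinear.Build K A K^o _ pr1 pr1_linear.

(** An explicit candidate for the powers of the maximal ideal. Written as kernels of surjections,
    its terms have dimensions given by rank-nullity. *)
Definition filtr i : {vspace A} :=
  match i with
  | 0 => fullv
  | 1 => lker (linfun pr1)
  | 2 => lker (linfun (unit_pair below2))
  | 3 => lker (linfun (unit_pair below3))
  | 4 => lker (linfun (unit_pair below4))
  | _ => 0%VS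
  end.

Lemma cx0 : cx (0 : N) =1 fun=> 0. Proof. by move=> i; exact: ffunE. Qed.
Lemma cy0 : cy (0 : N) =1 fun=> 0. Proof. by move=> i; exact: ffunE. Qed.
Lemma cz0 : cz (0 : N) =1 fun=> 0. Proof. by move=> i; exact: ffunE. Qed.
Lemma cw0 : cw (0 : N) =1 fun=> 0. Proof. by move=> i; exact: ffunE. Qed.
Lemma cv0 : cv (0 : N) =1 fun=> 0. Proof. by move=> i; exact: ffunE. Qed.
Lemma cf0 : cf (0 : N) =1 fun=> 0. Proof. by move=> i; exact: ffunE. Qed.

Let ffun_eq0 (I : finType) (f : {ffun I -> K^o}) : f = 0 <-> f =1 fun=> 0.
Proof.
split=> [-> j|f0]; first exact: ffunE.
by apply/ffunP => j; rewrite f0 ffunE.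
Qed.

Let pair_eq0 (V W : nmodType) (x : V * W) : x = 0 <-> x.1 = 0 /\ x.2 = 0.
Proof. by split=> [-> //|]; case: x => x y /= [-> ->]. Qed.

Lemma below2_eq0 p : below2 p = 0 <->
  [/\ cx p =1 fun=> 0, cy p =1 fun=> 0 & cz p =1 fun=> 0].
Proof.
rewrite pair_eq0 pair_eq0 !ffun_eq0; split=> [[[]]|[]]; by split.
Qed.

Lemma below3_eq0 p : below3 p = 0 <->
  below2 p = 0 /\ (cw p =1 fun=> 0) /\ (cv p =1 fun=> 0).
Proof. by rewrite pair_eq0 (pair_eq0 (below3 p).2) !ffun_eq0. Qed.

Lemma below4_eq0 p : below4 p = 0 <-> below3 p = 0 /\ cf p =1 fun=> 0.
Proof. by rewrite pair_eq0 (ffun_eq0 (below4 p).2). Qed.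

Lemma apolar_nil_eq0 p : p = 0 <-> below4 p = 0 /\ ct p = 0.
Proof.
split=> [->|[/below4_eq0[/below3_eq0[/below2_eq0[x0 y0 z0] [w0 v0]] f0] t0]].
  by split; [exact: linear0|].
apply: apolar_nilP => [i|i|i|i|i|i|].
- by rewrite x0 cx0.
- by rewrite y0 cy0.
- by rewrite z0 cz0.
- by rewrite w0 cw0.
- by rewrite v0 cv0.
- by rewrite f0 cf0.
exact: t0.
Qed.

Lemma mem_filtr i a : a \in filtr i.+1 <-> a.1 = 0 /\ deg_ge i.+1 a.2.
Proof.
case: i => [|[|[|[|i]]]].
- rewrite memv_ker lfunE /= /pr1; split=> [/eqP e|[/eqP //]].
  by split=> //; split.
- rewrite mem_unit_pair_ker below2_eq0; split=> [[a0 h]|[a0 [h _ _ _]]].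
    by split=> //; split.
  by split=> //; exact: h.
- rewrite mem_unit_pair_ker below3_eq0 below2_eq0.
  split=> [[a0 [h h']]|[a0 [h h' _ _]]].
    by split=> //; split.
  by split=> //; split; [exact: h|exact: h'].
- rewrite mem_unit_pair_ker below4_eq0 below3_eq0 below2_eq0.
  split=> [[a0 [[h h'] h'']]|[a0 [h h' h'' _]]].
    by split=> //; split.
  by split=> //; split; [split; [exact: h|exact: h']|exact: h''].
rewrite memv0; split=> [/eqP->|[a0 [h h' h'' h''']]].
  split=> //; split=> // _; last exact: cf0; split.
  - exact: cx0.
  - exact: cy0.
  - exact: cz0.
  - exact: cw0.
  - exact: cv0.
apply/eqP; rewrite (unit_embE a0) (_ : a.2 = 0) ?linear0 //.
apply/apolar_nil_eq0; rewrite below4_eq0 below3_eq0 below2_eq0.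
by split; [split; [split; [exact: h|exact: h']|exact: h'']|exact: h'''].
Qed.

Lemma dim_filtr :
  [/\ \dim (filtr 0) = (1 + (n + b + c) + (#|J| + b) + n + 1)%N,
      \dim (filtr 1) = (n + b + c + (#|J| + b) + n + 1)%N,
      \dim (filtr 2) = (#|J| + b + n + 1)%N,
      \dim (filtr 3) = (n + 1)%N &
      \dim (filtr 4) = 1%N].
Proof.
pose dF (I : finType) := dim {ffun I -> K^o}.
have dimF (I : finType) : dF I = #|I| by rewrite /dF /dim /= muln1.
have dimo k : dF 'I_k = k by rewrite dimF card_ord.
have dimN : dim N = (dF 'I_n + dF 'I_b + dF 'I_c + (dF J + dF 'I_b) +
    dF 'I_n + 1)%N by [].
have d1 : (\dim (filtr 1) + 1 = 1 + dim N)%N.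
  by apply: dim_lker_onto => y; exists (y, 0).
have d2 : (\dim (filtr 2) + (dF 'I_n + dF 'I_b + dF 'I_c) = dim N)%N.
  by apply: dim_unit_pair_ker => y; exists (y, 0, 0, 0).
have d3 : (\dim (filtr 3) +
    (dF 'I_n + dF 'I_b + dF 'I_c + (dF J + dF 'I_b)) = dim N)%N.
  by apply: dim_unit_pair_ker => y; exists (y, 0, 0).
have d4 : (\dim (filtr 4) +
    (dF 'I_n + dF 'I_b + dF 'I_c + (dF J + dF 'I_b) + dF 'I_n) = dim N)%N.
  by apply: dim_unit_pair_ker => y; exists (y, 0).
have d0 : \dim (filtr 0) = (1 + dim N)%N by rewrite dimvf.
move: (filtr 0) (filtr 1) (filtr 2) (filtr 3) (filtr 4) d0 d1 d2 d3 d4.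
rewrite dimN !dimo dimF => ? ? ? ? ? d0 d1 d2 d3 d4; split; lia.
Qed.

(** Every term of a coordinate of the product contains a coordinate of [p'] of strictly smaller
    degree. *)
Lemma deg_ge_mul i p p' : deg_ge i.+1 p' -> deg_ge i.+2 (cn_mul p p').
Proof.
move=> [h2 h3 h4 h5]; rewrite /cn_mul /=; split=> [_|ge|ge|ge].
- by split=> j; rewrite mkNE.
- have [x0 y0 z0] := h2 ge; split=> j; rewrite mkNE.
    by rewrite [X in _ * X](eq_ell L x0) ell0 mulr0.
  by rewrite y0 mulr0.
- have [x0 y0 z0] := h2 (ltnW ge); have [w0 v0] := h3 ge => j; rewrite mkNE.
  rewrite big1 // => q _.
  by rewrite w0 (eq_ell L x0) ell0 mulr0 mul0r addr0 mulr0.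
have [x0 y0 z0] := h2 (ltnW (ltnW ge)); have [w0 v0] := h3 (ltnW ge).
have f0 := h4 ge; rewrite mkNE.
rewrite !big1 ?addr0 // => j _;
  by rewrite ?w0 ?x0 ?y0 ?z0 ?f0 ?v0 !(mulr0, mul0r, addr0).
Qed.

Local Notation m := (filtr 1).

Lemma unit_emb_filtr i p : unit_emb p \in filtr i.+1 <-> deg_ge i.+1 p.
Proof. by rewrite mem_filtr; split=> [[]|]. Qed.

Lemma filtr1_mul i a a' : a \in m -> a' \in filtr i -> a * a' \in filtr i.+1.
Proof.
move=> /mem_filtr[a0 _]; case: i => [_|i /mem_filtr[a'0 h]]; apply/mem_filtr.
  by split; [rewrite unit_mul1 a0 mul0r|split].
split; first by rewrite unit_mul1 a0 mul0r.
by rewrite unit_mul2 //; exact: deg_ge_mul.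
Qed.

Lemma filtr1_ideal : is_ideal m.
Proof.
by move=> a x xm; rewrite mulrC; apply: filtr1_mul xm _; exact: memvf.
Qed.

Lemma filtr1_codim a : exists k : K, a - k *: 1 \in m.
Proof.
exists a.1; apply/mem_filtr; split; last by split.
by rewrite unit_sub_scalar subrr.
Qed.

Lemma filtr1_neqf : m != fullv.
Proof.
apply/eqP => mf; have : (1 : A) \in m by rewrite mf memvf.
by move/mem_filtr => [/eqP + _]; rewrite oner_eq0.
Qed.

Lemma filtr1_maximal : maximal_ideal m.
Proof.
split; [exact: filtr1_ideal|exact: filtr1_neqf|].
move=> I I_ideal le_mI I_neqf; apply/eqP; rewrite eqEsubv le_mI andbT.
apply/subvP => a aI; have [k am] := filtr1_codim a.
have kI : k *: 1 \in I by rewrite -[_ *: 1](subKr a) rpredB // (subvP le_mI).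
(* If [k = 0] then [a] is in [m]; otherwise [I] contains a unit and is everything. *)
have [k0|k_neq0] := eqVneq k 0; first by rewrite k0 scale0r subr0 in am.
case/eqP: I_neqf; apply/eqP; rewrite eqEsubv subvf; apply/subvP => x _.
by rewrite -[x]mulr1 -[1](scalerK k_neq0) -scalerAr rpredZ // I_ideal.
Qed.

Local Notation o := (fun=> 0).

Definition vx (x : 'I_n -> K) : N := mkN x o o o o o 0.
Definition vy (y : 'I_b -> K) : N := mkN o y o o o o 0.
Definition vw (w : J -> K) : N := mkN o o o w o o 0.
Definition vf (f : 'I_n -> K) : N := mkN o o o o o f 0.
Definition vt (t : K) : N := mkN o o o o o o t.

Local Notation delta i := (fun j => (j == i)%:R : K).

Lemma coordN p :
  (forall i, cx (- p) i = - cx p i) *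
  (forall i, cy (- p) i = - cy p i) *
  (forall i, cz (- p) i = - cz p i) *
  (forall i, cw (- p) i = - cw p i) *
  (forall i, cv (- p) i = - cv p i) *
  (forall i, cf (- p) i = - cf p i).
Proof. by rewrite -scaleN1r; do 5?split; move=> i; rewrite coordZ mulN1r. Qed.

Lemma coord_sum (I : finType) (F : I -> N) :
  (forall i, cx (\sum_j F j) i = \sum_j cx (F j) i) *
  (forall i, cy (\sum_j F j) i = \sum_j cy (F j) i) *
  (forall i, cz (\sum_j F j) i = \sum_j cz (F j) i) *
  (forall i, cw (\sum_j F j) i = \sum_j cw (F j) i) *
  (forall i, cv (\sum_j F j) i = \sum_j cv (F j) i) *
  (forall i, cf (\sum_j F j) i = \sum_j cf (F j) i).
Proof.
do 5?split.
- move=> i; apply: (big_morph (fun p => cx p i)) => [p p'|].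
    by rewrite coordD.
  exact: cx0.
- move=> i; apply: (big_morph (fun p => cy p i)) => [p p'|].
    by rewrite coordD.
  exact: cy0.
- move=> i; apply: (big_morph (fun p => cz p i)) => [p p'|].
    by rewrite coordD.
  exact: cz0.
- move=> i; apply: (big_morph (fun p => cw p i)) => [p p'|].
    by rewrite coordD.
  exact: cw0.
- move=> i; apply: (big_morph (fun p => cv p i)) => [p p'|].
    by rewrite coordD.
  exact: cv0.
- move=> i; apply: (big_morph (fun p => cf p i)) => [p p'|].
    by rewrite coordD.
  exact: cf0.
Qed.

Lemma ct_mul p p' : ct (cn_mul p p') =
  \sum_q cw p q * cw p' q + \sum_i (cx p i * cf p' i + cx p' i * cf p i) +
  \sum_k (cy p k * cv p' k + cy p' k * cv p k) + \sum_l cz p l * cz p' l.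
Proof. by rewrite /cn_mul /= mkNE. Qed.

Lemma ct_mulE p x y z w v f t : ct (cn_mul p (mkN x y z w v f t)) =
  \sum_q cw p q * w q + (\sum_i cx p i * f i + \sum_i cf p i * x i) +
  (\sum_k cy p k * v k + \sum_k cv p k * y k) + \sum_l cz p l * z l.
Proof.
rewrite ct_mul -!big_split; congr (_ + _ + _ + _);
  apply: eq_bigr => i _; by rewrite !mkNE //= ?(mulrC (cf _ _)) ?(mulrC (cv _ _)).
Qed.

(** The socle coordinate of a product pairs [x] with [f], [y] with [v], and [w] and [z] each with
    itself. Unit vectors thus detect every coordinate of an annihilating element except [t]. *)
Lemma socle_filtr : socle m = filtr 4.
Proof.
apply/vspaceP => a; apply/socleP/idP => [ann|am x xm]; last first.
  by apply/eqP; rewrite -memv0 mulrC (filtr1_mul xm am).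
have embm p : unit_emb p \in m by apply/unit_emb_filtr; split.
have ann2 p : a.1 *: p + cn_mul a.2 p = 0.
  by rewrite -unit_mul_emb (ann _ (embm p)).
have sum0 (I : finType) (g : I -> K) : \sum_i g i * 0 = 0.
  by rewrite -mulr_suml mulr0.
(* Multiplying [a] by the socle generator multiplies that generator by the scalar part of [a]. *)
have a0 : a.1 = 0.
  have := congr1 (@ct K n b c J) (ann2 (vt 1)).
  by rewrite coordD coordZ ct_mulE mkNE !sum0 !addr0 mulr1.
have h x y z w v f (t : K) : \sum_q cw a.2 q * w q +
    (\sum_i cx a.2 i * f i + \sum_i cf a.2 i * x i) +
    (\sum_k cy a.2 k * v k + \sum_k cv a.2 k * y k) + \sum_l cz a.2 l * z l = 0.
  rewrite -(ct_mulE _ x y z w v f t).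
  by rewrite -(unit_mul2 (a := a) (a' := unit_emb _)) // (ann _ (embm _)).
have red := (sum0, sum_delta, addr0, add0r).
apply/mem_filtr; split=> //; split=> // _; [split|split|] => i.
- by rewrite -(h o o o o o (delta i) 0) !red.
- by rewrite -(h o o o o (delta i) o 0) !red.
- by rewrite -(h o o (delta i) o o o 0) !red.
- by rewrite -(h o o o (delta i) o o 0) !red.
- by rewrite -(h o (delta i) o o o o 0) !red.
- by rewrite -(h (delta i) o o o o o 0) !red.
Qed.

Section Generated.
Variables (i0 : 'I_n) (d : 'I_n -> J).
(** The form with index [d j] is the variable [X_j]. *)
Hypothesis L_d : forall i j, L i (d j) = (i == j)%:R.
(** The dual form of the linear independence of the squares [L_q^2]: quadratic operators take
    arbitrary values on them. *)
Hypothesis L_span : forall w : J -> K, exists C : 'I_n -> 'I_n -> K,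
  forall q, w q = \sum_i \sum_j C i j * (L i q * L j q).

Lemma ell_delta i q : ell L (delta i) q = L i q.
Proof. exact: sum_delta. Qed.

Lemma ell_vx x q : ell L (cx (vx x)) q = ell L x q.
Proof. by apply: eq_ell => i; rewrite mkNE. Qed.

Lemma ell_vf f q : ell L (cx (vf f)) q = 0.
Proof. by rewrite (@eq_ell _ _ _ _ _ o) ?ell0 // => i; rewrite mkNE. Qed.

Lemma ell_vy y q : ell L (cx (vy y)) q = 0.
Proof. by rewrite (@eq_ell _ _ _ _ _ o) ?ell0 // => i; rewrite mkNE. Qed.

Lemma ell_vw w q : ell L (cx (vw w)) q = 0.
Proof. by rewrite (@eq_ell _ _ _ _ _ o) ?ell0 // => i; rewrite mkNE. Qed.

Lemma unit_emb_sum_mem (I : finType) (F : I -> N) (V : {vspace A}) :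
  (forall i, unit_emb (F i) \in V) -> unit_emb (\sum_i F i) \in V.
Proof. by move=> FV; rewrite raddf_sum; apply: memv_suml => i _; exact: FV. Qed.

Lemma unit_emb_sub_mem p p' (V : {vspace A}) :
  unit_emb (p - p') \in V -> unit_emb p' \in V -> unit_emb p \in V.
Proof. by move=> pV p'V; rewrite -[p](subrK p') linearD memvD. Qed.

Lemma unit_emb_mul_mem i p p' : deg_ge 1 p -> deg_ge i.+1 p' ->
  unit_emb (cn_mul p p') \in (m * filtr i.+1)%VS.
Proof.
by move=> hp hp'; rewrite unit_embM memv_mul //; apply/unit_emb_filtr.
Qed.

Lemma filtr4_sub : (filtr 4 <= m * filtr 3)%VS.
Proof.
apply/subvP => a /mem_filtr[/unit_embE -> [h2 h3 h4 _]].
have [[[x0 y0 z0] [w0 v0]] f0] := (h2 isT, h3 isT, h4 isT).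
(* Degrees 1 and 3 pair perfectly, so one variable and its dual vector in degree 3 produce any
   multiple of the socle generator. *)
have -> : a.2 = cn_mul (vx (delta i0)) (vf (fun j => ct a.2 * (j == i0)%:R)).
  rewrite /cn_mul /=; apply: apolar_nilP => [i|i|i|i|i|i|]; rewrite !mkNE.
  - by rewrite x0.
  - by rewrite y0.
  - by rewrite z0.
  - by rewrite w0 ell_vf mulr0.
  - by rewrite v0 mul0r.
  - by rewrite f0 big1 // => q _; rewrite !mkNE ell_vf mul0r addr0 !mulr0.
  rewrite [\sum_q _]big1 => [|q _]; last by rewrite mkNE mul0r.
  rewrite [\sum_(k < b) _]big1 => [|k _]; last by rewrite !mkNE !mul0r addr0.
  rewrite [\sum_(l < c) _]big1 => [|l _]; last by rewrite !mkNE mul0r.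
  under eq_bigr => i _ do rewrite !mkNE mul0r addr0 mulrC.
  by rewrite sum_delta eqxx mulr1 add0r !addr0.
by apply: unit_emb_mul_mem; split=> // _; [split|split] => i; rewrite mkNE.
Qed.

(** By [L_d], multiplying the [i]-th unit vector of degree 1 by the value 1 on the square with index
    [d i] gives the [i]-th unit vector of degree 3. The sum [r] thus matches [f], and the remainder
    falls under [filtr4_sub]. *)
Lemma filtr3_sub : (filtr 3 <= m * filtr 2)%VS.
Proof.
apply/subvP => a /mem_filtr[/unit_embE -> [h2 h3 _ _]].
have [[x0 y0 z0] [w0 v0]] := (h2 isT, h3 isT).
pose r := \sum_i cn_mul (vx (delta i)) (vw (fun q => cf a.2 i * (q == d i)%:R)).
apply: (unit_emb_sub_mem (p' := r)); last first.
  apply: unit_emb_sum_mem => i.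
  by apply: unit_emb_mul_mem; split=> // _; split => j; rewrite mkNE.
apply: (subvP (prodvSr m _)) (subvP filtr4_sub _ _).
  apply/subvP => x /mem_filtr[x1 [hx2 hx3 _ _]].
  by apply/mem_filtr; split=> //; split.
apply/unit_emb_filtr; split=> // _; [split=> i|split=> i|move=> i];
  rewrite coordD coordN coord_sum.
- by rewrite x0 big1 ?subrr // => j _; rewrite mkNE.
- by rewrite y0 big1 ?subrr // => j _; rewrite mkNE.
- by rewrite z0 big1 ?subrr // => j _; rewrite mkNE.
- by rewrite w0 big1 ?subrr // => j _; rewrite mkNE ell_vw mulr0.
- by rewrite v0 big1 ?subrr // => j _; rewrite !mkNE mul0r.
apply/eqP; rewrite subr_eq0 eq_sym -(sum_delta (cf a.2)); apply/eqP.
apply: eq_bigr => j _; rewrite mkNE.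
rewrite [LHS](eq_bigr (fun q => L i q * (L j q * cf a.2 j) * (q == d j)%:R)).
  by rewrite sum_delta !L_d eqxx mul1r mulrC eq_sym.
by move=> q _; rewrite ell_vw mkNE ell_vx ell_delta; ring.
Qed.

(** The sum [rx] realizes the values [w] through [L_span], and [ry] realizes [v] by squares of the
    [d/dY_k]. The remainder lies in [filtr 3], already covered by [filtr3_sub]. *)
Lemma filtr2_sub : (filtr 2 <= m * m)%VS.
Proof.
apply/subvP => a /mem_filtr[/unit_embE -> [h2 _ _ _]].
have [x0 y0 z0] := h2 isT; have [C CE] := L_span (cw a.2).
pose rx := \sum_i \sum_j
  cn_mul (vx (delta i)) (vx (fun l => C i j * (l == j)%:R)).
pose ry := \sum_k cn_mul (vy (delta k)) (vy (fun l => cv a.2 k * (l == k)%:R)).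
apply: (unit_emb_sub_mem (p' := rx + ry)); last first.
  rewrite linearD memvD //; apply: unit_emb_sum_mem => i.
    by apply: unit_emb_sum_mem => j; apply: unit_emb_mul_mem.
  by apply: unit_emb_mul_mem.
apply: (subvP (prodvSr m _)) (subvP filtr3_sub _ _).
  by apply/subvP => x /mem_filtr[x1 _]; apply/mem_filtr; split=> //; split.
have coord_rx : [/\ cx rx =1 fun=> 0, cy rx =1 fun=> 0, cz rx =1 fun=> 0,
    cw rx =1 cw a.2 & cv rx =1 fun=> 0].
  split=> q; rewrite coord_sum;
      first [rewrite CE; apply: eq_bigr|rewrite big1] => // i _;
      rewrite coord_sum; first [apply: eq_bigr|rewrite big1] => // j _;
      rewrite ?mkNE //.
    by rewrite !ell_vx ellZ !ell_delta mulrCA.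
  by rewrite mul0r.
have coord_ry : [/\ cx ry =1 fun=> 0, cy ry =1 fun=> 0, cz ry =1 fun=> 0,
    cw ry =1 fun=> 0 & cv ry =1 cv a.2].
  split=> q; rewrite coord_sum; try by rewrite big1 // => k _; rewrite mkNE.
    by rewrite big1 // => k _; rewrite mkNE ell_vy mul0r.
  rewrite -[RHS]sum_delta; apply: eq_bigr => k _.
  by rewrite !mkNE eq_sym mulrCA -natrM mulnb andbb.
have [rx0 ry0 rz0 rw rv] := coord_rx; have [sx sy sz sw sv] := coord_ry.
apply/unit_emb_filtr; split=> // _; split=> i; rewrite coordD coordN coordD.
- by rewrite x0 rx0 sx addr0 subrr.
- by rewrite y0 ry0 sy addr0 subrr.
- by rewrite z0 rz0 sz addr0 subrr.
- by rewrite rw sw addr0 subrr.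
- by rewrite rv sv add0r subrr.
Qed.

Lemma filtrS i : (filtr i.+1 <= m * filtr i)%VS.
Proof.
case: i => [|[|[|[|i]]]].
2-5: by [exact: filtr2_sub|exact: filtr3_sub|exact: filtr4_sub|exact: sub0v].
by rewrite -[X in (X <= _)%VS]prodv1; apply: prodvSr; exact: subvf.
Qed.

Lemma ideal_exp_filtr i : ideal_exp m i = filtr i.
Proof.
elim: i => [//|i IHi]; rewrite /ideal_exp iterS -/(ideal_exp m i) IHi.
apply/eqP; rewrite eqEsubv filtrS andbT.
by apply/prodvP => x y; exact: filtr1_mul.
Qed.

Lemma gorenstein_Osequence_apolar :
  gorenstein_Osequence K [:: 1; n + b + c; #|J| + b; n; 1]%N.
Proof.
have [d0 d1 d2 d3 d4] := dim_filtr.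
exists A, m; split.
- apply: (@artinian_local_nilpotent _ _ m 5).
  + exact: mulrC.
  + exact: filtr1_ideal.
  + by rewrite ideal_exp_filtr.
  + exact: filtr1_codim.
- exact: filtr1_maximal.
- by rewrite /gorenstein socle_filtr d4.
exists 4%N.
  split; first by rewrite ideal_exp_filtr -dimv_eq0 d4.
  move=> j; rewrite ideal_exp_filtr.
  by case: j => [|[|[|[|[|j]]]]] //=; rewrite eqxx.
rewrite /mkseq /= /hilbert_fun !ideal_exp_filtr d0 d1 d2 d3 d4 dimv0.
congr [:: _; _; _; _; _]; move: #|J| => j; clear; lia.
Qed.

End Generated.

End Hilbert.

(** * Linear forms with linearly independent squares *)

Lemma gorenstein_Osequence_socle4 (K : fieldType) (n q b c : nat) :
    (0 < n)%N -> (n <= q <= 'C(n.+1, 2))%N ->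
  gorenstein_Osequence K [:: 1; n + b + c; q + b; n; 1]%N.
Proof.
move=> n_gt0; rewrite -card_le_pairs => q_bounds.
(* The diagonal [D] indexes the variables themselves. The index set [G] lies between [D] and [F], of
   sizes [n] and ['C(n.+1, 2)], so every admissible [q] occurs as its size. *)
pose D := [set (i, i) | i : 'I_n].
have cardD : #|D| = n by rewrite card_imset ?card_ord // => i j [].
pose F := [set p : 'I_n * 'I_n | (p.1 <= p.2)%N].
have sDF : D \subset F by apply/subsetP => _ /imsetP[i _ ->]; rewrite inE /=.
rewrite -{1}cardD in q_bounds.
have [G [sDG sGF <-]] := subset_of_card sDF q_bounds.
pose J : finType := {p : 'I_n * 'I_n | p \in G}.
have -> : #|G| = #|J| by rewrite card_sig.
have dG i : (i, i) \in G by apply: (subsetP sDG); apply: imset_f.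
pose d i : J := exist (fun p => is_true (p \in G)) (i, i) (dG i).
(* L_(i, i) = X_i and L_(i, j) = X_i + X_j for i < j. *)
pose L (i : 'I_n) (p : J) : K := ((i == (val p).1) || (i == (val p).2))%:R.
apply: (@gorenstein_Osequence_apolar _ _ _ _ _ L (Ordinal n_gt0) d) => [i j|w].
  by rewrite /L /= orbb.
(* By polarization, a quadratic form is determined by its values at the e_i and
   the e_i + e_j. *)
pose C i j := if i == j then w (d i) else
  if insub (i, j) is Some p then w p - w (d i) - w (d j) else 0.
exists C => p.
have lt_p : (val p).1 = (val p).2 \/ ((val p).1 < (val p).2)%N.
  have := subsetP sGF _ (valP p); rewrite inE leq_eqVlt.
  by case/orP=> [/eqP/val_inj|]; [left|right].
have sum2 k l : \sum_i \sum_j C i j * ((i == k)%:R * (j == l)%:R) = C k l.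
  under eq_bigr => i _ do under eq_bigr => j _ do rewrite mulrA.
  by under eq_bigr => i _ do rewrite sum_delta; rewrite sum_delta.
have Ckk k : C k k = w (d k) by rewrite /C eqxx.
case: lt_p => [eq_p|lt_p].
  have -> : p = d (val p).1.
    by apply: val_inj; case: p eq_p => -[k l] pG /= ->.
  rewrite -Ckk -sum2; apply: eq_bigr => i _; apply: eq_bigr => j _.
  by rewrite /L /= !orbb.
case: p lt_p => -[k l] pG /= lt_kl.
have neq_kl : k != l by rewrite neq_ltn lt_kl.
have Ckl : C k l = w (exist _ (k, l) pG) - w (d k) - w (d l).
  rewrite /C (negPf neq_kl); case: insubP => [u _ uE|]; last by rewrite pG.
  by congr (w _ - _ - _); apply: val_inj.
(* The matrix [C] is upper triangular, because pairs in [G] have their smaller entry first. *)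
have Clk : C l k = 0.
  rewrite /C eq_sym (negPf neq_kl); case: insubP => // u /(subsetP sGF).
  by rewrite inE /= leqNgt lt_kl.
have LE i : L i (exist _ (k, l) pG) = (i == k)%:R + (i == l)%:R.
  rewrite /L /=; have [->|_] := eqVneq i k; last by rewrite add0r.
  by rewrite (negPf neq_kl) addr0.
(* Expanding the square of [X_k + X_l] leaves [C k k + C l l + C k l + C l k], in which [C k l] was
   chosen to make the total [w] at [(k, l)]. *)
under eq_bigr => i _ do under eq_bigr => j _ do rewrite !LE mulrDl !mulrDr.
under eq_bigr => i _ do rewrite !big_split /=.
rewrite !big_split /= !sum2 !Ckk Ckl Clk.
ring.
Qed.

(** * From Hilbert functions to numerical conditions and back *)

Local Open Scope nat_scope.

Lemma gorenstein_Osequence_bounds (K : fieldType) (s : nat) (h : seq nat) :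
  2 <= s -> size h = s.+1 -> nth 0 h 0 = 1 -> nth 0 h s = 1 ->
  gorenstein_Osequence K h ->
  nth 0 h (s - 1) <= nth 0 h 1 /\
  nth 0 h (s - 2) <=
    'C(nth 0 h (s - 1) + 1, 2) + (nth 0 h 1 - nth 0 h (s - 1)).
Proof.
move=> s_ge2 size_h h0 hs [A [m [A_local [m_ideal _ _] dim_socle]]].
move=> [s' [Ms_neq0 max_s] h_eq]; move: size_h.
rewrite h_eq size_mkseq => -[s's]; subst s'.
have hE i : i <= s -> nth 0 h i = hilbert_fun m i.
  by move=> le_is; rewrite h_eq nth_mkseq.
rewrite -h_eq !hE //; try lia.
have mulC := artinian_local_mulC A_local.
have Ms1 : ideal_exp m s.+1 = 0%VS.
  by apply/eqP/negP => /negP/max_s; rewrite ltnn.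
(* The power [m^s] is nonzero and killed by [m], hence fills the one-dimensional socle. *)
have socle_s : socle m = ideal_exp m s.
  apply/esym/eqP; rewrite eqEdim dim_socle; apply/andP; split.
    apply/subvP => a am; apply/socleP => x xm; apply/eqP.
    rewrite -memv0 -Ms1 mulC -add1n.
    by apply: ideal_exp_mul; rewrite ?ideal_exp1.
  by rewrite lt0n dimv_eq0.
have [phi phi_s] := exists_functional dim_socle.
apply: (@gorenstein_bounds _ _ _ _ phi) => //.
- by move=> a; rewrite -socle_s => /phi_s; apply.
- by rewrite -hE.
- by rewrite -hE.
Qed.

Theorem theorem2 (K : closedFieldType) (charK0 : [pchar K]%R =i pred0) :
  (forall (s : nat) (h : seq nat),
     3 <= s -> size h = s.+1 -> nth 0 h 0 = 1 -> nth 0 h s = 1 ->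
     gorenstein_Osequence K h ->
     nth 0 h (s - 1) <= nth 0 h 1 /\
     nth 0 h (s - 2) <=
       'C(nth 0 h (s - 1) + 1, 2) + (nth 0 h 1 - nth 0 h (s - 1))) /\
  (forall h1 h2 h3 : nat,
     unimodal [:: 1; h1; h2; h3; 1] ->
     Osequence [:: 1; h1; h2; h3; 1] ->
     h3 <= h1 ->
     h2 <= 'C(h3 + 1, 2) + (h1 - h3) ->
     gorenstein_Osequence K [:: 1; h1; h2; h3; 1]).
Proof.
split=> [s h s_ge3|h1 h2 h3 [j _ [inc dec]] [h_gt0 _ _ _] le31 le2].
  by apply: gorenstein_Osequence_bounds; exact: ltnW.
have h3_gt0 : 0 < h3 by apply: (allP h_gt0); rewrite !inE eqxx !orbT.
(* If the peak is at index at most 2, the sequence descends from [h2] to [h3]; otherwise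
   [h3 <= h1 <= h2]. *)
have le32 : h3 <= h2.
  have [le_j2|lt_2j] := leqP j 2; first exact: (dec 2).
  exact: leq_trans le31 (inc 1 (ltnW lt_2j)).
have le_n : h3 <= 'C(h3.+1, 2) by rewrite binS bin1 leq_addl.
(* By truncation, [h2 - b] is the minimum of [h2] and ['C(h3.+1, 2)], hence an admissible number of
   fourth powers. The bound [le2] says that [b <= h1 - h3], which leaves [h1 - h3 - b] squares. *)
rewrite addn1 in le2; pose b := h2 - 'C(h3.+1, 2).
have := @gorenstein_Osequence_socle4 K h3 (h2 - b) b (h1 - h3 - b) h3_gt0.
rewrite !subnK /b; try lia.
rewrite (_ : h3 + _ + _ = h1); last by lia.
by apply; apply/andP; split; lia.
Qed.
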